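(* Let $S$, $C$ and $L$ be the sufficiency, conditionality and likelihood relations on the set $\mathcal{I}$ of inference bases, and let $\overline{S\cup C}$ be the smallest equivalence relation on $\mathcal{I}$ containing $S\cup C$. Then $S\cup C$ is properly contained in $L$, while $L=\overline{S\cup C}$.
   Context: A relation on a set $D$ is a subset $R\subset D\times D$; $\bar{R}$ denotes the equivalence relation generated by $R$, i.e. the smallest equivalence relation on $D$ containing $R$. A (discrete) model is $E=(\mathcal{X}_E,\{f_{E,\theta}:\theta\in\Theta_E\})$, where $\mathcal{X}_E$ is a nonempty countable (possibly finite) sample space, $\Theta_E$ is a nonempty parameter set, and each $f_{E,\theta}$ is a probability function on $\mathcal{X}_E$ (nonnegative with total sum 1). An inference base is a pair $I=(E,x)$ with $E$ a model and $x\in\mathcal{X}_E$ (the observed data). $\mathcal{I}$ is the set of all inference bases (all sets drawn from a fixed universe). Write $I_i=(E_i,x_i)$. Likelihood relation $L$: $(I_1,I_2)\in L$ iff $\Theta_{E_1}=\Theta_{E_2}$ and there is $c>0$ with $f_{E_1,\theta}(x_1)=c f_{E_2,\theta}(x_2)$ for every $\theta$. A statistic on $E$ is a function with domain $\mathcal{X}_E$. Sufficiency is understood pointwise: $m$ is sufficient for $E$ if $m(x)=m(y)$ implies that there is $k>0$ with $f_{E,\theta}(x)=k f_{E,\theta}(y)$ for all $\theta$; $m$ is minimal sufficient if it is sufficient and is a function of every sufficient statistic (equivalently, $m(x)=m(y)$ iff such a $k>0$ exists). The marginal model induced by $m$ has sample space $m(\mathcal{X}_E)$, parameter set $\Theta_E$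 and probability functions $t\mapsto\sum_{x:m(x)=t}f_{E,\theta}(x)$. Sufficiency relation $S$: $(I_1,I_2)\in S$ iff $\Theta_{E_1}=\Theta_{E_2}$ and there exist minimal sufficient statistics $m_1$ for $E_1$ and $m_2$ for $E_2$ such that the marginal models induced by $m_1$ and $m_2$ are the same and $m_1(x_1)=m_2(x_2)$. A statistic $a$ is ancillary for $E$ if for each value $t$ the probability $\sum_{x:a(x)=t}f_{E,\theta}(x)$ does not depend on $\theta$. If $a$ is ancillary and $a(x_0)$ has positive probability $q$, the conditional model given $a(x_0)$ has sample space $\{x\in\mathcal{X}_E:a(x)=a(x_0)\}$, parameter set $\Theta_E$, and probability functions $x\mapsto f_{E,\theta}(x)/q$. Conditionality relation $C$: $(I_1,I_2)\in C$ iff $\Theta_{E_1}=\Theta_{E_2}$ and, possibly after exchanging the roles of $I_1$ and $I_2$, there is an ancillary statistic $a$ for $E_1$, with $a(x_1)$ having positive probability, such that the conditional model of $E_1$ given $a(x_1)$, with data $x_1$, is $(E_2,x_2)$ up to labelling of sample points: there is a bijection from $\{x:a(x)=a(x_1)\}$ onto $\mathcal{X}_{E_2}$ that sends $x_1$ to $x_2$ and carries the conditional probability function to $f_{E_2,\theta}$ for every $\theta$. *)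

(* Defs.v *)
From Stdlib Require Export Relation_Definitions.
From HB Require Import structures.
From mathcomp Require Export all_boot all_order all_algebra.
From mathcomp Require Export all_classical all_reals ereal esum.

Set Implicit Arguments.
Unset Strict Implicit.
Unset Printing Implicit Defensive.
Import Order.TTheory GRing.Theory Num.Theory.
Local Open Scope classical_set_scope.
Local Open Scope ring_scope.

(* All sample points are elements of a type [U] and all parameter values are
   elements of a type [P]; sample spaces and parameter sets are subsets, so that
   two models can be compared by equality of sets.  [prob E] is only meaningful
   on [param E] x [sample E]; [prob_out] pins it to 0 elsewhere so that Leibniz
   equality of models is equality of (sample space, parameter set, functions). *)
Record model (R : realType) (U : choiceType) (P : Type) := Model {
  sample : set U;
  param : set P;
  prob : P -> U -> R;
  sample_neq0 : sample !=set0;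
  sample_countable : countable sample;
  param_neq0 : param !=set0;
  prob_ge0 : forall th x, param th -> sample x -> 0 <= prob th x;
  prob_sum1 : forall th, param th ->
    (\esum_(x in sample) (prob th x)%:E = 1)%E;
  prob_out : forall th x, ~ (param th /\ sample x) -> prob th x = 0 }.

Section Models.
Context (R : realType) (U : choiceType) (P : Type).

Lemma model_eq (E1 E2 : model R U P) :
  sample E1 = sample E2 -> param E1 = param E2 -> prob E1 = prob E2 -> E1 = E2.
Proof.
case: E1 => X1 T1 f1 a1 b1 c1 d1 e1 g1; case: E2 => X2 T2 f2 a2 b2 c2 d2 e2 g2.
move=> /= eX eT ef; subst X2 T2 f2.
by congr Model; exact: Prop_irrelevance.
Qed.

Lemma prob_nneg (E : model R U P) th x : 0 <= prob E th x.
Proof.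
case: (pselect (param E th /\ sample E x)) => [[? ?]|h]; first exact: prob_ge0.
by rewrite prob_out.
Qed.

Lemma le_esumZ (A : set U) (c : R) (f : U -> R) : 0 < c ->
  (\esum_(x in A) (c * f x)%:E <= c%:E * \esum_(x in A) (f x)%:E)%E.
Proof.
move=> c0; apply: ge_ereal_sup => _ [X [finX XA] <-].
have -> : (\sum_(x \in X) (c * f x)%:E = c%:E * \sum_(x \in X) (f x)%:E)%E.
  by rewrite !fsumEFin// -EFinM mulr_fsumr.
by rewrite lee_pmul2l ?lte_fin//; apply: ereal_sup_ubound; exists X.
Qed.

(* A statistic on [E] is represented by a function [m : U -> T]; every notion
   below only depends on its restriction to [sample E]. *)

Definition stat_prob (T : Type) (E : model R U P) (m : U -> T) (th : P) (t : T)
    : R :=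
  fine (\esum_(x in sample E `&` m @^-1` [set t]) (prob E th x)%:E)%E.

Lemma stat_probE (T : Type) (E : model R U P) (m : U -> T) th t :
  ((stat_prob E m th t)%:E =
   \esum_(x in sample E `&` m @^-1` [set t]) (prob E th x)%:E)%E.
Proof.
rewrite /stat_prob fineK// ge0_fin_numE; last first.
  by apply: esum_ge0 => x _; rewrite lee_fin prob_nneg.
have [pth|npth] := pselect (param E th); last first.
  rewrite esum1 ?ltry// => x _; by rewrite prob_out// => -[/npth].
apply: (@le_lt_trans _ _ 1%E); last exact: ltry.
rewrite -(prob_sum1 pth) esum_mkcondr; apply: le_esum => x _.
by case: ifP => // _; rewrite lee_fin prob_nneg.
Qed.

Lemma stat_prob_ge0 (T : Type) (E : model R U P) (m : U -> T) th t :
  0 <= stat_prob E m th t.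
Proof.
by rewrite -lee_fin stat_probE; apply: esum_ge0 => x _; rewrite lee_fin prob_nneg.
Qed.

Definition sufficient (T : Type) (E : model R U P) (m : U -> T) : Prop :=
  forall x y, sample E x -> sample E y -> m x = m y ->
    exists2 k : R, 0 < k &
      forall th, param E th -> prob E th x = k * prob E th y.

Definition minimal_sufficient (T : Type) (E : model R U P) (m : U -> T)
    : Prop :=
  sufficient E m /\
  forall (T' : Type) (m' : U -> T'), sufficient E m' ->
    exists h : T' -> T, forall x, sample E x -> m x = h (m' x).

Definition ancillary (T : Type) (E : model R U P) (a : U -> T) : Prop :=
  forall t th1 th2, param E th1 -> param E th2 ->
    stat_prob E a th1 t = stat_prob E a th2 t.

Section Marginal.
Context (T : choiceType) (E : model R U P) (m : U -> T).

Lemma marginal_neq0 : m @` sample E !=set0.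
Proof. by case: (sample_neq0 E) => x Ex; exists (m x), x. Qed.

Lemma marginal_countable : countable (m @` sample E).
Proof. exact/(card_le_trans (card_image_le _ _))/sample_countable. Qed.

Lemma marginal_sum1 th : param E th ->
  (\esum_(t in m @` sample E) (stat_prob E m th t)%:E = 1)%E.
Proof.
move=> pth; pose J t := sample E `&` m @^-1` [set t].
have -> : (\esum_(t in m @` sample E) (stat_prob E m th t)%:E =
    \esum_(t in m @` sample E) \esum_(x in J t) (prob E th x)%:E)%E.
  by apply: eq_esum => t _; rewrite stat_probE.
rewrite esum_esum; last by move=> t x _ _; rewrite lee_fin prob_nneg.
rewrite (@reindex_esum _ _ _ (sample E) _ (fun x => (m x, x))).
  exact: prob_sum1.
split; first by move=> x Ex; split; [exists x|split].
  by move=> x y _ _ [].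
by move=> [t x] [_ [/= Ex <-]]; exists x.
Qed.

Lemma marginal_out th t : ~ (param E th /\ (m @` sample E) t) ->
  stat_prob E m th t = 0.
Proof.
move=> h; apply: EFin_inj; rewrite stat_probE esum1// => x [Ex /= mx].
by rewrite prob_out// => -[pth _]; apply: h; split => //; exists x.
Qed.

Definition marginal : model R T P :=
  Model marginal_neq0 marginal_countable (param_neq0 E)
    (fun th t _ _ => stat_prob_ge0 E m th t) marginal_sum1 marginal_out.

End Marginal.

Section Conditional.
Context (T : Type) (E : model R U P) (a : U -> T) (t : T)
  (q_gt0 : forall th, param E th -> 0 < stat_prob E a th t).

Definition fiber : set U := [set x | sample E x /\ a x = t].

Definition cond_prob (th : P) (x : U) : R :=
  if x \in fiber then prob E th x / stat_prob E a th t else 0.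

Lemma cond_neq0 : fiber !=set0.
Proof.
have [th pth] := param_neq0 E; have := q_gt0 pth.
apply: contraPP => /nonemptyPn f0; apply/negP; rewrite -leNgt.
rewrite -lee_fin stat_probE (_ : _ `&` _ = set0) ?esum_set0//.
Qed.

Lemma cond_countable : countable fiber.
Proof.
apply: sub_countable (sample_countable E); apply: subset_card_le.
by move=> x [].
Qed.

Lemma cond_ge0 th x : param E th -> fiber x -> 0 <= cond_prob th x.
Proof.
move=> pth _; rewrite /cond_prob; case: ifP => // _.
by rewrite divr_ge0 ?prob_nneg// ltW// q_gt0.
Qed.

Lemma cond_sum1 th : param E th -> (\esum_(x in fiber) (cond_prob th x)%:E = 1)%E.
Proof.
move=> pth; have q0 := q_gt0 pth; set q := stat_prob E a th t in q0 *.
have sq : (\esum_(x in fiber) (prob E th x)%:E = q%:E)%E by rewrite stat_probE.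
have -> : (\esum_(x in fiber) (cond_prob th x)%:E =
           \esum_(x in fiber) (q^-1 * prob E th x)%:E)%E.
  by apply: eq_esum => x fx; rewrite /cond_prob mem_set// mulrC.
apply/eqP; rewrite eq_le; apply/andP; split.
  apply: (le_trans (le_esumZ _ _ _)); first by rewrite invr_gt0.
  by rewrite sq -EFinM mulVf// gt_eqF.
have := le_esumZ fiber (fun x => q^-1 * prob E th x) q0.
under eq_esum do rewrite mulVKf ?gt_eqF//.
by rewrite sq -{1}[q%:E]mule1 lee_pmul2l ?lte_fin.
Qed.

Lemma cond_out th x : ~ (param E th /\ fiber x) -> cond_prob th x = 0.
Proof.
rewrite /cond_prob; case: ifPn => // /set_mem fx h.
by rewrite prob_out ?mul0r// => -[pth _]; apply: h.
Qed.

Definition conditional : model R U P :=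
  Model cond_neq0 cond_countable (param_neq0 E) cond_ge0 cond_sum1 cond_out.

End Conditional.

Record inference_base := InferenceBase {
  base_model : model R U P;
  data : U;
  dataP : sample base_model data }.

Definition likelihood : set (inference_base * inference_base) :=
  [set I | let E1 := base_model I.1 in let E2 := base_model I.2 in
    param E1 = param E2 /\
    exists2 c : R, 0 < c & forall th, param E1 th ->
      prob E1 th (data I.1) = c * prob E2 th (data I.2)].

Definition sufficiency : set (inference_base * inference_base) :=
  [set I | let E1 := base_model I.1 in let E2 := base_model I.2 in
    param E1 = param E2 /\
    exists (T : choiceType) (m1 m2 : U -> T),
      [/\ minimal_sufficient E1 m1, minimal_sufficient E2 m2,
          marginal E1 m1 = marginal E2 m2 & m1 (data I.1) = m2 (data I.2)]].

(* [E1] with data [x1] is [E2] with data [x2] up to labelling of sample points *)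
Definition relabelling (E1 : model R U P) (x1 : U) (E2 : model R U P) (x2 : U)
    : Prop :=
  param E1 = param E2 /\
  exists g : U -> U, [/\ set_bij (sample E1) (sample E2) g, g x1 = x2 &
    forall th x, param E1 th -> sample E1 x ->
      prob E2 th (g x) = prob E1 th x].

Definition conditions_to (I1 I2 : inference_base) : Prop :=
  exists (T : Type) (a : U -> T),
    ancillary (base_model I1) a /\
    exists q_gt0 : forall th, param (base_model I1) th ->
        0 < stat_prob (base_model I1) a th (a (data I1)),
      relabelling (conditional q_gt0) (data I1) (base_model I2) (data I2).

Definition conditionality : set (inference_base * inference_base) :=
  [set I | param (base_model I.1) = param (base_model I.2) /\
           (conditions_to I.1 I.2 \/ conditions_to I.2 I.1)].

End Models.

Definition equivalence_set (D : Type) (Q : set (D * D)) : Prop :=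
  equivalence D (fun x y => Q (x, y)).

Definition generated_equivalence (D : Type) (Q : set (D * D)) : set (D * D) :=
  smallest (@equivalence_set D) Q.

(* Main.v *)
Require Import Defs.

(** Both [S] and [C] only rescale the likelihood function. If [m] is sufficient,
the likelihood of the value [m x] in the marginal model is a constant times the
likelihood of [x] ([stat_prob_sufficient]), so two inference bases with the same
marginal model and the same value of the statistic have proportional likelihoods.
Conditioning on an ancillary statistic divides the likelihood by a probability
that is free of the parameter. Since [L] is an equivalence relation, it contains
the equivalence relation generated by [S `|` C].

Conversely, let [(E1, x1)] and [(E2, x2)] have proportional likelihoods. As in
Birnbaum's theorem, toss a fair coin to decide which of the two experiments is
performed: this is a [mixture] of disjoint copies of [E1] and [E2], which exist
because the universe of sample points is infinite and sample spaces are countable.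
The result of the toss is ancillary, so [C] relates each [(Ei, xi)] to the mixture
with data the copy of [xi] ([conditions_to_embedded]). The copies of [x1] and [x2]
have proportional likelihoods within one and the same model, so its minimal
sufficient statistic identifies them, and [S] relates the two remaining inference
bases ([sufficiency_of_likelihood]). The chain [C], [S], [C] joins [(E1, x1)] to
[(E2, x2)].

The inclusion is proper because of null points. On a sample space [{a, b}], compare
the point mass at [a] with the uniform model, both free of the parameter and both
with data [a]. The likelihoods are constant, hence proportional. A minimal sufficient
statistic separates [a] from [b] in the first model and is constant in the second, so
[S] fails; conditioning neither creates nor removes null points in the fiber, so a
model of two points with one null is never a conditional model of the uniform one, nor
conversely, and [C] fails. *)

Set Implicit Arguments.
Unset Strict Implicit.
Unset Printing Implicit Defensive.
Import Order.TTheory GRing.Theory Num.Theory.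
Local Open Scope ring_scope.
Local Open Scope classical_set_scope.

Section Likelihood.
Context (R : realType) (U : choiceType) (P : Type).
Implicit Types (E F : model R U P) (I J : inference_base R U P).

(** * Sufficiency and conditionality preserve the likelihood *)

Lemma esumZ (V : choiceType) (A : set V) (c : R) (f : V -> R) : 0 <= c ->
  (\esum_(x in A) (c * f x)%:E = c%:E * \esum_(x in A) (f x)%:E)%E.
Proof.
rewrite le_eqVlt => /predU1P[<-|c0].
  by rewrite mul0e esum1// => x _; rewrite mul0r.
apply/eqP; rewrite eq_le le_esumZ//=.
rewrite -[leRHS]mul1e -(mulfV (lt0r_neq0 c0)) EFinM -muleA lee_pmul2l ?lte_fin//.
apply: le_trans (le_esumZ _ _ _); last by rewrite invr_gt0.
by under [leRHS]eq_esum do rewrite mulKf ?gt_eqF//.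
Qed.

(** All points of a fiber of [m] have likelihoods proportional to that of [x], so their
sum is again proportional to it. *)
Lemma stat_prob_sufficient (T : Type) E (m : U -> T) x :
  sufficient E m -> sample E x ->
  exists2 K : R, 0 < K &
    forall th, param E th -> stat_prob E m th (m x) = K * prob E th x.
Proof.
move=> suf Ex.
(* If [x] has probability 0 for all parameters, so has its whole fiber, and any
   constant will do. Otherwise a parameter [th0] charging [x] determines the
   constant. *)
have [/existsNP[th0 /not_implyP[pth0 /eqP x0]]|/contrapT zero] := 
    pselect (~ forall th, param E th -> prob E th x = 0); last first.
  exists 1 => // th pth; rewrite zero// mulr0; apply: EFin_inj.
  rewrite stat_probE esum1// => y [Ey my].
  by have [k _ ->] := suf _ _ Ey Ex my; rewrite ?zero ?mulr0.
have {}x0 : 0 < prob E th0 x by rewrite lt_neqAle eq_sym x0 prob_nneg.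
have prop th : param E th -> stat_prob E m th (m x) =
    prob E th x / prob E th0 x * stat_prob E m th0 (m x).
  move=> pth; apply: EFin_inj; rewrite EFinM !stat_probE -esumZ; last first.
    by rewrite divr_ge0// prob_nneg.
  apply: eq_esum => y [Ey my]; have [k k0 ky] := suf _ _ Ey Ex my.
  by congr EFin; rewrite !ky// mulrCA divfK ?gt_eqF.
exists (stat_prob E m th0 (m x) / prob E th0 x); last first.
  by move=> th pth; rewrite prop// [LHS]mulrC mulrA mulrAC.
(* The fiber of [x] is at least as probable as [x] itself under [th0]. *)
rewrite divr_gt0// (lt_le_trans x0)// -lee_fin stat_probE.
rewrite -[leLHS](@esum_set1 _ _ x (fun y => (prob E th0 y)%:E)) ?lee_fin ?prob_nneg//.
rewrite esum_mkcond [leRHS]esum_mkcond; apply: le_esum => y _.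
case: ifPn => [/set_mem ->|_]; first by rewrite mem_set.
by case: ifP => // _; rewrite lee_fin prob_nneg.
Qed.

Lemma sufficiency_sub_likelihood :
  @sufficiency R U P `<=` @likelihood R U P.
Proof.
move=> [I1 I2] [/= eT [T [m1 [m2 [[suf1 _] [suf2 _] eM em]]]]]; split => //.
have [K1 K10 h1] := stat_prob_sufficient suf1 (dataP I1).
have [K2 K20 h2] := stat_prob_sufficient suf2 (dataP I2).
exists (K2 / K1); first by rewrite divr_gt0.
move=> th pth; have pth2 : param (base_model I2) th by rewrite -eT.
have := congr1 (fun M => prob M th (m2 (data I2))) eM => /=.
rewrite h2// -em h1// => e.
by rewrite mulrAC -e mulrC mulKf ?gt_eqF.
Qed.

Lemma equivalence_likelihood : equivalence_set (@likelihood R U P).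
Proof.
split => [I|I J K [/= eIJ [c c0 cE]] [/= eJK [d d0 dE]]|I J [/= eIJ [c c0 cE]]].
- by split => //; exists 1 => // th _; rewrite mul1r.
- split; first by rewrite eIJ.
  exists (c * d); first by rewrite mulr_gt0.
  by move=> th pth /=; rewrite cE// dE -?eIJ// mulrA.
- split => //; exists c^-1; first by rewrite invr_gt0.
  by move=> th pth /=; rewrite cE ?eIJ// mulKf ?gt_eqF.
Qed.

Lemma conditions_to_likelihood I J :
  conditions_to I J -> @likelihood R U P (I, J).
Proof.
move=> [T [a [anc [q_gt0 [/= eT [g [bij_g gx gE]]]]]]]; split => //=.
have [th0 pth0] := param_neq0 (base_model I).
exists (stat_prob (base_model I) a th0 (a (data I))); first exact: q_gt0.
move=> th pth; have fib : fiber (base_model I) a (a (data I)) (data I).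
  by split => //; exact: dataP.
rewrite -gx gE// /cond_prob mem_set// (anc _ _ th)// mulrC divfK//.
by rewrite gt_eqF// q_gt0.
Qed.

Lemma conditionality_sub_likelihood :
  @conditionality R U P `<=` @likelihood R U P.
Proof.
have [_ _ sym] := equivalence_likelihood.
by move=> [I J] [_ [/=|/= /conditions_to_likelihood/sym//]];
  exact: conditions_to_likelihood.
Qed.

(** * Fair mixtures of two models *)

Section Mixture.
Context (E1 E2 : model R U P) (eT : param E1 = param E2).

(** No case distinction is needed, since [prob] vanishes outside the sample space. For
overlapping sample spaces this is the mixture that forgets which component was
observed. *)
Definition mixture_prob th x := 2^-1 * (prob E1 th x + prob E2 th x).

Lemma mixture_neq0 : sample E1 `|` sample E2 !=set0.
Proof. by have [x Ex] := sample_neq0 E1; exists x; left. Qed.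

Lemma mixture_countable : countable (sample E1 `|` sample E2).
Proof.
rewrite -bigcup2E; apply: bigcup_countable => [|[|[|n]] _ /=].
- exact: countableP.
- exact: sample_countable.
- exact: sample_countable.
- exact: countable0.
Qed.

Lemma mixture_ge0 th x : param E1 th -> (sample E1 `|` sample E2) x ->
  0 <= mixture_prob th x.
Proof. by rewrite mulr_ge0 ?addr_ge0 ?prob_nneg// invr_ge0. Qed.

Lemma esum_prob_sup E (A : set U) th : sample E `<=` A ->
  param E th -> (\esum_(x in A) (prob E th x)%:E = 1)%E.
Proof.
move=> EA pth; rewrite -(prob_sum1 pth) -[in RHS](setIidr EA) esum_mkcondr.
apply: eq_esum => x _; case: ifPn => // /negP xE.
by rewrite prob_out// => -[_ /mem_set].
Qed.

Lemma mixture_sum1 th : param E1 th ->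
  (\esum_(x in sample E1 `|` sample E2) (mixture_prob th x)%:E = 1)%E.
Proof.
move=> pth; rewrite esumZ ?invr_ge0//.
under eq_esum do rewrite EFinD.
rewrite esumD; try by move=> x _; rewrite lee_fin prob_nneg.
rewrite (esum_prob_sup (@subsetUl _ _ _))// (esum_prob_sup (@subsetUr _ _ _)).
  by rewrite -EFinD -EFinM mulVf.
by rewrite -eT.
Qed.

Lemma mixture_out th x : ~ (param E1 th /\ (sample E1 `|` sample E2) x) ->
  mixture_prob th x = 0.
Proof.
move=> out; rewrite /mixture_prob !prob_out ?addr0 ?mulr0//.
  by move=> [pth Ex]; apply: out; rewrite eT; split => //; right.
by move=> [pth Ex]; apply: out; split => //; left.
Qed.

Definition mixture : model R U P :=
  Model mixture_neq0 mixture_countable (param_neq0 E1) mixture_ge0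
    mixture_sum1 mixture_out.

End Mixture.

(** Relabelling the sample points of [E] by [g] is the same thing as passing to the
marginal model of the one-to-one statistic [g]. *)
Lemma stat_prob_inj (V : choiceType) E (g : U -> V) th x :
  {in sample E &, injective g} -> sample E x ->
  stat_prob E g th (g x) = prob E th x.
Proof.
move=> inj_g Ex; apply: EFin_inj; rewrite stat_probE.
rewrite (_ : _ `&` _ = [set x]) ?esum_set1 ?lee_fin ?prob_nneg//.
apply/seteqP; split => [y [Ey /= gyx]|_ ->//].
by apply: inj_g => //; exact: mem_set.
Qed.

(** The conditionality step. If [E] restricted to the image of [g] is a copy of [F]
weighted by a constant [w], then the indicator of this image is ancillary, and
conditioning on it gives back [F]. *)
Lemma conditions_to_embedded I J (g : U -> U) (w : R) :
  let E := base_model I in let F := base_model J in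
  0 < w -> param E = param F ->
  {in sample F &, injective g} -> g @` sample F `<=` sample E ->
  g (data J) = data I ->
  (forall th x, param F th -> sample F x ->
     prob E th (g x) = w * prob F th x) ->
  conditions_to I J.
Proof.
move=> E F w0 eT inj_g gFE gx gE.
pose a z := z \in g @` sample F.
have fiberE : fiber E a true = g @` sample F.
  apply/seteqP; split => [z [_] /set_mem//|z gFz].
  by split; [exact: gFE|exact: mem_set].
have at_w th : param E th -> stat_prob E a th true = w.
  move=> pth; apply: EFin_inj; rewrite stat_probE -[_ `&` _]/(fiber E a true).
  rewrite fiberE esum_image; last exact: inj_g.
  under eq_esum do rewrite gE -?eT//.
  by rewrite esumZ ?ltW// prob_sum1 -?eT// mule1.
have af_w th : param E th -> stat_prob E a th false = 1 - w.
  move=> pth; have := prob_sum1 pth; rewrite (esumID (a @^-1` [set true])).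
    rewrite -(stat_probE E a th) (_ : ~` (a @^-1` [set true]) = a @^-1` [set false]); last first.
      by apply/seteqP; split => z /=; case: (a z).
    rewrite -(stat_probE E a th) -EFinD at_w// => -[<-].
    by rewrite addrC addKr.
  by move=> x _; rewrite lee_fin prob_nneg.
have adata : a (data I) = true.
  by apply: mem_set; exists (data J) => //; exact: dataP.
exists bool, a; split.
  by case=> th1 th2 pth1 pth2; rewrite ?at_w ?af_w.
have q0 th : param E th -> 0 < stat_prob E a th (a (data I)).
  by move=> pth; rewrite adata at_w.
exists q0; split => //; exists ('pinv_(fun=> data J) (sample F) g); split.
- rewrite /= adata fiberE; exact: injpinv_bij.
- by rewrite -gx pinvKV//; apply: mem_set; exact: dataP.
- move=> th z /= pth; rewrite adata /cond_prob at_w// => fz.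
  rewrite mem_set//; move: fz; rewrite fiberE => -[x Fx <-].
  by rewrite pinvKV ?gE -?eT ?mem_set// mulrC mulKf ?gt_eqF.
Qed.

(** Two countable sets fit side by side into an infinite type: the points of a sequence
without repetitions with even index receive the first one, those with odd index the
second one. *)
Lemma infinite_disjoint_copies (A B : set U) :
  infinite_set [set: U] -> countable A -> countable B ->
  exists g1 g2 : U -> U, [/\ {in A &, injective g1}, {in B &, injective g2} &
    forall x y, g1 x <> g2 y].
Proof.
move=> /infiniteP/card_leP[f] /countable_injP[e1 inj1] /countable_injP[e2 inj2].
pose u n : U := val (f (SigSub (mem_set (I : [set: nat] n)))).
have inj_u : injective u.
  by move=> m n /val_inj /(inj (in_setT _) (in_setT _))[].
exists (fun x => u (e1 x).*2), (fun x => u (e2 x).*2.+1); split.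
- by move=> x y Ax Ay /inj_u/double_inj/inj1; apply.
- by move=> x y Bx By /inj_u[] /double_inj/inj2; apply.
- by move=> x y /inj_u /(congr1 odd); rewrite /= !odd_double.
Qed.

(** * Minimal sufficient statistics *)

Definition proportional E : set (U * U) :=
  [set z | exists2 k : R, 0 < k &
    forall th, param E th -> prob E th z.1 = k * prob E th z.2].

Lemma equivalence_proportional E : equivalence_set (proportional E).
Proof.
split => [x|x y z [c c0 cE] [d d0 dE]|x y [c c0 cE]].
- by exists 1 => // th _; rewrite mul1r.
- exists (c * d); first by rewrite mulr_gt0.
  by move=> th pth; rewrite cE// dE// mulrA.
- exists c^-1; first by rewrite invr_gt0.
  by move=> th pth; rewrite cE// mulKf ?gt_eqF.
Qed.

(** The minimal sufficient statistic sends a point to a representative of its class of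
proportionality, chosen as a function of the class. Values can thus be taken in the
type of sample points itself. *)
Lemma exists_minimal_sufficient E : exists m : U -> U,
  minimal_sufficient E m /\
  forall x y, sample E x -> sample E y -> proportional E (x, y) -> m x = m y.
Proof.
have [rfl trs sym] := equivalence_proportional E.
have [x0 _] := sample_neq0 E.
pose class x := [set y | sample E y /\ proportional E (x, y)].
pose m x := xget x0 (class x).
have mP x : sample E x -> class x (m x).
  by move=> Ex; apply: xgetPex; exists x.
have m_eq x y : proportional E (x, y) -> m x = m y.
  move=> xy; congr xget; apply/seteqP; split => z [Ez xz]; split => //.
    exact: trs (sym _ _ xy) xz.
  exact: trs xy xz.
exists m; split; last by move=> x y _ _; exact: m_eq.
split=> [x y Ex Ey mxy|T' m' suf'].
  have [_ xm] := mP _ Ex; have [_ ym] := mP _ Ey.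
  by apply: trs xm _; rewrite mxy; exact: sym.
(* A value [t] of [m'] is sent to the value of [m] at any point of the fiber over [t]:
   two points of this fiber are proportional because [m'] is sufficient. *)
exists (fun t => m (xget x0 [set x | sample E x /\ m' x = t])) => x Ex.
have [|Ey m'y] := @xgetPex _ x0 [set y | sample E y /\ m' y = m' x].
  by exists x.
by apply: m_eq; apply: suf'.
Qed.

(** Within a single model, proportional observations are identified by one minimal
sufficient statistic, and the two marginal models are trivially the same. *)
Lemma sufficiency_of_likelihood E x1 x2 (Ex1 : sample E x1) (Ex2 : sample E x2) :
  let I1 := InferenceBase Ex1 in let I2 := InferenceBase Ex2 in
  @likelihood R U P (I1, I2) -> @sufficiency R U P (I1, I2).
Proof.
move=> I1 I2 [_ /= prop]; split => //.
have [m [min_m m_eq]] := exists_minimal_sufficient E.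
by exists U, m, m; split => //; exact: m_eq.
Qed.

(** * The likelihood relation is generated by sufficiency and conditionality *)

(** Birnbaum's argument: [I1] and [I2] are both conditional inference bases of the fair
mixture [E] of disjoint copies of their models, and the copies of their data are
related by sufficiency in [E]. *)
Lemma likelihood_sub_equivalence (Q : set _) :
  infinite_set [set: U] -> equivalence_set Q ->
  @sufficiency R U P `|` @conditionality R U P `<=` Q ->
  @likelihood R U P `<=` Q.
Proof.
move=> infU [rfl trs sym] SCQ [I1 I2] [/= eT [c c0 cE]].
set E1 := base_model I1 in eT cE; set E2 := base_model I2 in eT cE.
have [g1 [g2 [inj1 inj2 disj]]] := infinite_disjoint_copies infU
  (sample_countable E1) (sample_countable E2).
pose F1 := marginal E1 g1; pose F2 := marginal E2 g2.
pose E := mixture (eT : param F1 = param F2).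
have prob1 th x : sample E1 x -> prob E th (g1 x) = 2^-1 * prob E1 th x.
  move=> Ex; rewrite /= /mixture_prob /= stat_prob_inj//.
  by rewrite marginal_out ?addr0// => -[_ [y _ /esym/disj]].
have prob2 th x : sample E2 x -> prob E th (g2 x) = 2^-1 * prob E2 th x.
  move=> Ex; rewrite /= /mixture_prob /= (@stat_prob_inj _ E2)//.
  by rewrite marginal_out ?add0r// => -[_ [y _ /disj]].
have Ez1 : sample E (g1 (data I1)) by left; exists (data I1) => //; exact: dataP.
have Ez2 : sample E (g2 (data I2)) by right; exists (data I2) => //; exact: dataP.
have half0 : 0 < 2^-1 :> R by rewrite invr_gt0.
pose J1 := InferenceBase Ez1; pose J2 := InferenceBase Ez2.
have Q1 : Q (J1, I1).
  apply: SCQ; right; split => //; left.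
  apply: (conditions_to_embedded half0 _ inj1) => //; first by move=> z; left.
  by move=> th x _; exact: prob1.
have Q2 : Q (J2, I2).
  apply: SCQ; right; split => //; left.
  apply: (conditions_to_embedded half0 _ inj2) => //; first by move=> z; right.
  by move=> th x _; exact: prob2.
have Q12 : Q (J1, J2).
  apply: SCQ; left; apply: sufficiency_of_likelihood; split => //.
  exists c => // th pth; rewrite [LHS]prob1; last exact: dataP.
  by rewrite [X in c * X]prob2 ?cE//; [rewrite mulrCA|exact: dataP].
exact: trs (sym _ _ Q1) (trs _ _ _ Q12 Q2).
Qed.

(** * Properness of the inclusion *)

Section Dirac.
Context (A : set U) (a : U) (A_countable : countable A) (Aa : A a)
  (P_neq0 : [set: P] !=set0).

Definition dirac_prob (th : P) (x : U) : R := (x == a)%:R.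

Lemma dirac_neq0 : A !=set0. Proof. by exists a. Qed.

Lemma dirac_ge0 th x : [set: P] th -> A x -> 0 <= dirac_prob th x.
Proof. by rewrite /dirac_prob ler0n. Qed.

Lemma dirac_sum1 th : [set: P] th ->
  (\esum_(x in A) (dirac_prob th x)%:E = 1)%E.
Proof.
move=> _; rewrite (esumID [set a]); last by move=> x _; rewrite lee_fin ler0n.
rewrite setIidr => [|_ ->//].
rewrite esum_set1 ?lee_fin ?ler0n// esum1 ?adde0 ?/dirac_prob ?eqxx//.
by move=> x [_ /eqP/negbTE xa]; rewrite xa.
Qed.

Lemma dirac_out th x : ~ ([set: P] th /\ A x) -> dirac_prob th x = 0.
Proof.
move=> out; rewrite /dirac_prob; case: eqP => // xa.
by exfalso; apply: out; rewrite xa.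
Qed.

Definition dirac_model : model R U P :=
  Model dirac_neq0 A_countable P_neq0 dirac_ge0 dirac_sum1 dirac_out.

End Dirac.

(** The point mass at [a] on [{a, b}] and the uniform model on [{a, b}], both with data
[a]: the former has a null point and the latter has none, which neither relation can
ignore. *)
Lemma likelihood_not_sub_sufficiency_conditionality :
  infinite_set [set: U] -> [set: P] !=set0 ->
  exists2 z, @likelihood R U P z &
    ~ (@sufficiency R U P `|` @conditionality R U P) z.
Proof.
move=> infU P0; have [th pth] := P0.
have [a _] := infinite_setN0 infU.
have [b [_ /= /eqP ba]] :
    [set: U] `\` [set a] !=set0.
  by apply: infinite_setN0; apply: infinite_setD.
have ab : (a == b) = false by rewrite eq_sym (negbTE ba).
pose A := [set a; b].
have cA : countable A by apply: finite_set_countable; exact: finite_set2.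
have Aa : A a by left.
have Ab : A b by right.
pose E1 := dirac_model cA Aa P0.
pose E2 := @mixture E1 (dirac_model cA Ab P0) erefl.
have AE2 x : A x -> sample E2 x by left.
have E2A x : sample E2 x -> A x by case.
have prob2 t x : A x -> prob E2 t x = 2^-1.
  by case=> ->; rewrite /= /mixture_prob /= /dirac_prob eqxx ?ab ?(negbTE ba)
    ?addr0 ?add0r mulr1.
pose I1 := @InferenceBase R U P E1 a Aa.
pose I2 := @InferenceBase R U P E2 a (AE2 a Aa).
exists (I1, I2).
  split => //; exists 2 => // t _; rewrite prob2// mulfV//.
  by rewrite /= /dirac_prob eqxx.
case=> [[_ [T [m1 [m2 [[suf1 _] [_ min2] eM _]]]]]|[_ [|]]].
(* Sufficiency: the constant statistic is sufficient for the uniform model, so the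
   common marginal sample space is a singleton; but then [m1 a = m1 b] although [a]
   has probability 1 and [b] has probability 0. *)
- have [h hE] : exists h : unit -> T, forall x, sample E2 x -> m2 x = h tt.
    apply: (min2 unit (fun=> tt)) => x y /E2A Ax /E2A Ay _.
    by exists 1 => // t _; rewrite mul1r !prob2.
  have m1E x : A x -> m1 x = h tt.
    move=> Ax; have : sample (marginal E2 m2) (m1 x) by rewrite -eM; exists x.
    by move=> [y Ey <-]; exact: hE.
  have [|k _ /(_ th pth)] := suf1 a b Aa Ab; first by rewrite !m1E.
  by rewrite /= /dirac_prob eqxx (negbTE ba) mulr0 => /eqP; rewrite oner_eq0.
(* The point mass conditions to the uniform model: the point sent to [b] must have
   positive probability, hence be [a], which is sent to [a]. *)
- move=> [T [f [_ [q0 [_ [g [[_ _ surj] /= gx gE]]]]]]].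
  have [x [Ax fx] gxb] := surj b (AE2 b Ab).
  have := gE th x pth (conj Ax fx); rewrite gxb [LHS]prob2//.
  rewrite /= /cond_prob; case: ifP => _; last first.
    by move=> /eqP; rewrite invr_eq0 pnatr_eq0.
  have [xa|xb] := Ax.
    by move: gxb; rewrite xa gx => /eqP; rewrite ab.
  rewrite xb /= /dirac_prob (negbTE ba) mul0r.
  by move=> /eqP; rewrite invr_eq0 pnatr_eq0.
(* The uniform model conditions to the point mass: the point sent to [b] would be null
   in the uniform model. *)
- move=> [T [f [_ [q0 [_ [g [[_ _ surj] /= gx gE]]]]]]].
  have [x fx gxb] := surj b Ab.
  have := gE th x pth fx; rewrite gxb /= {1}/dirac_prob (negbTE ba).
  rewrite /cond_prob mem_set//.
  have Ax : A x by case: fx => -[].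
  rewrite [X in X / _]prob2// => /esym/eqP; rewrite mulf_eq0 !invr_eq0 pnatr_eq0 /=.
  by rewrite gt_eqF// q0.
Qed.

End Likelihood.

Theorem theorem8 (R : realType) (U : choiceType) (P : Type)
    (U_infinite : infinite_set [set: U]) (P_neq0 : [set: P] !=set0) :
  let S := @sufficiency R U P in
  let C := @conditionality R U P in
  let L := @likelihood R U P in
  S `|` C `<` L /\ L = generated_equivalence (S `|` C).
Proof.
move=> S C L.
have SCL : S `|` C `<=` L.
  by rewrite subUset; split; [exact: sufficiency_sub_likelihood|
                              exact: conditionality_sub_likelihood].
split.
  split => // LSC.
  have [z Lz] := likelihood_not_sub_sufficiency_conditionality R U_infinite P_neq0.
  by apply; exact: LSC.
apply/seteqP; split.
  by move=> z Lz Q [eqQ SCQ]; exact: likelihood_sub_equivalence Lz.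
exact: smallest_sub (equivalence_likelihood R U P) SCL.
Qed.
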